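(* Let $[a,b]$ be a bounded and nonempty compact interval of $\mathbb{R}$, let $\lambda$ be the Lebesgue measure on $[a,b]$, and let $f:[a,b]\to\mathbb{R}$ be a function bounded by some constant $M$ (i.e. $|f|\le M$). Then $f$ is Riemann integrable on $[a,b]$ if and only if $f$ is continuous $\lambda$-almost everywhere on $[a,b]$, and in that case its Riemann integral is equal to its Lebesgue integral: $$\int_a^b f(x)\,dx=\int_{[a,b]} f\,d\lambda .$$
   Context: ''Continuous $\lambda$-almost everywhere'' means that the set of points of $[a,b]$ at which $f$ is not continuous is a $\lambda$-null set. The Lebesgue integral is taken with respect to Lebesgue measure on the (complete) Lebesgue $\sigma$-algebra of $[a,b]$; the left-hand side of the displayed equality is the Riemann integral. *)

(* Defs.v *)
(* MathComp-Analysis over Stdlib's R, which is a realType through Rstruct.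
   Coquelicot is used only for its Riemann integral; it is not imported, since
   its notations clash with those of MathComp-Analysis. *)
From Stdlib Require Export Reals.
From Coquelicot Require Hierarchy RInt.
From mathcomp Require Export all_boot all_order all_algebra.
From mathcomp Require Export all_classical all_reals all_analysis.
From mathcomp Require Export Rstruct Rstruct_topology.
Export numFieldNormedType.Exports.

Local Open Scope classical_set_scope.
Local Open Scope ring_scope.

(* Points of the interval at which f, seen as a function on the subspace [a, b],
   is discontinuous: continuity at an endpoint is one-sided. *)
Definition discontinuity_set (a b : R) (f : R -> R) : set R :=
  [set x | x \in `[a, b] /\ ~ (f @ within `[a, b] (nbhs x) --> f x)].

(* Both Coquelicot notions below are limits of Riemann sums over pointed
   subdivisions as the mesh tends to 0; for a <= b they only depend on the
   values of f on [a, b]. *)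
Definition Riemann_integrable_on (a b : R) (f : R -> R) : Prop :=
  @RInt.ex_RInt Hierarchy.R_NormedModule f a b.

Definition Riemann_integral (a b : R) (f : R -> R) : R :=
  @RInt.RInt Hierarchy.R_CompleteNormedModule f a b.

(* Main.v *)
(* If f is continuous almost everywhere, the step functions attached to tagged
   subdivisions of mesh tending to 0 are bounded by M and converge to f almost
   everywhere, so by dominated convergence their integrals, which are the Riemann
   sums of f, converge to the Lebesgue integral of f.  Conversely, choose on each
   cell of a subdivision that meets the set E_k of points where f oscillates by
   at least k two tags where the values of f differ by at least k: the two
   Riemann sums then differ by at least k times the measure of a cover of E_k,
   so E_k is negligible when f is Riemann integrable. *)
Require Import Defs.
From Coquelicot Require Rcomplements SF_seq.
From mathcomp Require Import lra measurable_realfun.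
Import Order.TTheory GRing.Theory Num.Theory.
Local Open Scope classical_set_scope.
Local Open Scope ring_scope.

Local Notation leb := (@completed_lebesgue_measure R).
Local Notation lebesgueR := (caratheodory_type ((@wlength R idfun)^*)%mu).
Local Notation subdivision := (@SF_seq.SF_seq R).
Local Notation mesh s := (SF_seq.seq_step (SF_seq.SF_lx s)).
Local Notation start s := (SF_seq.SF_h s).
Local Notation stop s := (last (SF_seq.SF_h s) (SF_seq.SF_lx s)).
Local Notation Rsum := (@SF_seq.Riemann_sum Hierarchy.R_ModuleSpace).
Local Notation is_RInt := (@RInt.is_RInt Hierarchy.R_NormedModule).

(** * Riemann sums and the Riemann integral *)

Definition subdivides (a b : R) (s : subdivision) :=
  [/\ SF_seq.pointed_subdiv s, start s = a & stop s = b].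

(** The original definition covers both orientations: it multiplies each sum by the sign of [b - a]
    and takes the minimum and maximum of the endpoints. For [a < b] that sign is 1, and a plain
    epsilon-delta condition remains. *)
Lemma is_RIntP (a b I : R) (f : R -> R) : a < b ->
  is_RInt f a b I <->
  forall e, 0 < e -> exists2 d, 0 < d &
    forall s, subdivides a b s -> mesh s < d -> `|Rsum f s - I| < e.
Proof.
move=> ab; have [/RltP ab1 /RleP ab2] : a < b /\ a <= b by rewrite ltW.
have sg s : Rcomplements.sign (Rminus b a) * Rsum f s = Rsum f s.
  rewrite Rcomplements.sign_eq_1; last exact: Rlt_Rminus.
  exact: mul1r.
split=> [fI e e0|fI P [e eP]].
- have [|d dP] := fI (fun y => `|y - I| < e).
    exists (mkposreal _ (elimT RltP e0)) => y; rewrite /Hierarchy.ball/=.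
    by move=> /RltP; rewrite /Hierarchy.AbsRing_ball/= /Hierarchy.abs/= RabsE.
  exists (pos d); first exact/RltP/cond_pos.
  move=> s [s1 s2 s3] /RltP sd; rewrite -(sg s); apply: (dP s sd).
  by rewrite Rmin_left// Rmax_right.
- have [d d0 dP] := fI _ (introT RltP (cond_pos e)).
  exists (mkposreal _ (elimT RltP d0)) => s /RltP sd [s1 [s2 s3]].
  apply: eP; rewrite /= -[X in Hierarchy.ball _ _ X]/(_ * Rsum f s) sg.
  have /RltP : `|Rsum f s - I| < e.
    apply: dP => //; split=> //.
    - by rewrite s2 Rmin_left.
    - by rewrite s3 Rmax_right.
  by rewrite /Hierarchy.ball/= /Hierarchy.AbsRing_ball/= /Hierarchy.abs/= RabsE.
Qed.

Lemma pointed_subdiv_cons (x y : R) s :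
  SF_seq.pointed_subdiv (SF_seq.SF_cons (x, y) s) ->
  [/\ x <= y, y <= start s & SF_seq.pointed_subdiv s].
Proof.
move=> ps; have /= [/RleP ? /RleP ?] := ps 0%N (elimT ssrnat.ltP (ltn0Sn _)).
by split=> //; exact: SF_seq.ptd_cons ps.
Qed.

Lemma mesh_cons (x y : R) s :
  mesh (SF_seq.SF_cons (x, y) s) = Num.max `|start s - x| (mesh s).
Proof. by rewrite -RabsE -RmaxE. Qed.

Lemma Rsum_cons f (x y : R) s :
  Rsum f (SF_seq.SF_cons (x, y) s) = (start s - x) * f y + Rsum f s.
Proof. by rewrite SF_seq.Riemann_sum_cons. Qed.

(** * Riemann sums as Lebesgue integrals of step functions *)

Lemma measurable_leb_itv (i : interval R) :
  @measurable _ lebesgueR [set` i].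
Proof. by apply: sub_caratheodory; exact: measurable_itv. Qed.

Lemma leb_itv (x y : R) (b0 b1 : bool) : x <= y ->
  leb [set` Interval (BSide b0 x) (BSide b1 y)] = (y - x)%:E.
Proof.
move=> xy; rewrite -[LHS]/(lebesgue_measure _) lebesgue_measure_itv/= lte_fin.
by case: ltgtP xy => // -> _; rewrite subrr.
Qed.

Lemma itv_splitU (x y z : R) : x <= y -> y <= z ->
  `[x, z]%classic = `[x, y[ `|` `[y, z].
Proof.
move=> xy yz; apply/seteqP; split=> t /=; rewrite !in_itv/=.
  by move=> /andP[-> ->]; case: ltP => ?; [left|right].
by move=> [] /andP[]; lra.
Qed.

Lemma start_le_stop s : SF_seq.pointed_subdiv s -> start s <= stop s.
Proof.
elim/(@SF_seq.SF_cons_ind R): s => [x0|[x y] s IH]; first by rewrite /= lexx.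
by move=> /pointed_subdiv_cons[xy ys /IH]; exact/le_trans/(le_trans xy).
Qed.

(** The function is built cell by cell: it takes the value of [f] at the tag on each half-open cell,
    and [f] itself at the last point. Half-open cells are disjoint, so the integrals add up. The
    third property is what gives pointwise convergence at points of continuity. *)
Lemma Rsum_step_function (f : R -> R) s : SF_seq.pointed_subdiv s ->
  exists g : R -> R,
  [/\ measurable_fun (`[start s, stop s]%classic : set lebesgueR) (EFin \o g),
      (\int[leb]_(x in `[start s, stop s]) (g x)%:E = (Rsum f s)%:E)%E &
      forall x, start s <= x <= stop s ->
        exists y, [/\ start s <= y <= stop s, `|x - y| <= mesh s & g x = f y]].
Proof.
elim/(@SF_seq.SF_cons_ind R): s => [x0 _|[x y] s IH].
  exists (cst (f x0)); split.
  - exact: (measurable_cst (f x0)%:E).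
  - rewrite -[LHS]/(\int[leb]_(x in `[x0, x0]) cst (f x0)%:E x)%E.
    rewrite integral_cst; last exact: measurable_leb_itv.
    by rewrite /= leb_itv//= subrr mule0.
  - move=> x /=; rewrite andbC -eq_le => /eqP->; exists x0.
    by split; rewrite ?lexx// subrr normr0.
move=> /pointed_subdiv_cons[xy ys ps]; have [g [mg ig fg]] := IH ps.
have xs := le_trans xy ys; have ss := start_le_stop _ ps.
rewrite (_ : stop (SF_seq.SF_cons (x, y) s) = stop s)// [start (SF_seq.SF_cons _ _)]/=.
pose h t := if t < start s then f y else g t.
have h1 t : t \in `[x, start s[%classic -> cst (f y)%:E t = (EFin \o h) t.
  by rewrite inE/= in_itv/= /h => /andP[_ ->].
have h2 t : t \in `[start s, stop s]%classic -> (EFin \o g) t = (EFin \o h) t.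
  by rewrite inE/= in_itv/= /h; case: ltP => // ? /andP[]; lra.
have m1 : measurable_fun (`[x, start s[%classic : set lebesgueR) (EFin \o h).
  apply: (@eq_measurable_fun _ _ lebesgueR _ _ _ _ h1).
  exact: (measurable_cst (f y)%:E).
have m2 : measurable_fun (`[start s, stop s]%classic : set lebesgueR) (EFin \o h).
  exact: (@eq_measurable_fun _ _ lebesgueR _ _ _ _ h2).
exists h; split.
- rewrite (itv_splitU _ _ _ xs ss); apply/measurable_funU => //;
  exact: measurable_leb_itv.
- rewrite (itv_splitU _ _ _ xs ss) integral_setU.
  + rewrite (eq_integral (cst (f y)%:E)) => [|t /h1->//].
    rewrite [X in (_ + X)%E](@eq_integral _ lebesgueR _ _ _ (EFin \o g));
      last by move=> t /h2->.
    rewrite integral_cst; last exact: measurable_leb_itv.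
    by rewrite [X in (_ + X)%E]ig /= leb_itv// Rsum_cons muleC.
  + exact: measurable_leb_itv.
  + exact: measurable_leb_itv.
  + by apply/measurable_funU => //; exact: measurable_leb_itv.
  + apply/disj_setPS => t [] /=; rewrite !in_itv/=; lra.
- move=> t /andP[xt ts]; rewrite mesh_cons /h; case: ltP => tx.
    exists y; split => //; first by rewrite xy (le_trans ys).
    by rewrite le_max [`|start s - x|]ger0_norm ?subr_ge0// ler_norml; apply/orP; lra.
  have [|z [/andP[z1 z2] z3 ->]] := fg t; first by rewrite tx ts.
  exists z; split=> //; first by rewrite z2 (le_trans xs).
  by rewrite le_max z3 orbT.
Qed.

(** * Almost everywhere continuity and dominated convergence *)

Lemma cvg_withinP (K : realType) (D : set K) (f : K -> K) (x : K) :
  f @ within D (nbhs x) --> f x <->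
  forall e, 0 < e -> exists2 d, 0 < d &
    forall y, D y -> `|x - y| < d -> `|f x - f y| < e.
Proof.
split=> [/cvgrPdist_lt fx e /fx|fx].
  by move=> /nbhs_ballP[d d0 dP]; exists d => // y Dy xy; exact: dP.
apply/cvgrPdist_lt => e /fx[d d0 dP].
by apply/nbhs_ballP; exists d => // y xy Dy; exact: dP.
Qed.

(** Sequences are used because dominated convergence is a statement about them; [is_RInt_Lebesgue]
    returns to arbitrary subdivisions of small mesh. *)
Lemma Rsum_cvg_integral (a b M : R) (f : R -> R) (s : nat -> subdivision) :
  (forall x : R, x \in `[a, b] -> `|f x| <= M) ->
  leb.-negligible (discontinuity_set a b f) ->
  (forall n, subdivides a b (s n)) ->
  (forall d, 0 < d -> \forall n \near \oo, mesh (s n) < d) ->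
  leb.-integrable `[a, b] (EFin \o f) /\
  (Rsum f (s n))%:E @[n --> \oo] --> (\int[leb]_(x in `[a, b]) (f x)%:E)%E.
Proof.
move=> fM nD sab mesh0.
have /choice[g gP] n : exists g : R -> R,
  [/\ measurable_fun (`[a, b]%classic : set lebesgueR) (EFin \o g),
      (\int[leb]_(x in `[a, b]) (g x)%:E = (Rsum f (s n))%:E)%E &
      forall x, a <= x <= b ->
        exists y, [/\ a <= y <= b, `|x - y| <= mesh (s n) & g x = f y]].
  by have [ps <- <-] := sab n; exact: Rsum_step_function.
have ab : a <= b by have [/start_le_stop + <- <-] := sab 0%N.
have mI : @measurable _ lebesgueR `[a, b] by exact: measurable_leb_itv.
have gf x : a <= x <= b -> ~ discontinuity_set a b f x ->
    (g n x)%:E @[n --> \oo] --> (f x)%:E.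
  move=> xab /not_andP[//|]; rewrite notK => /cvg_withinP fx.
  apply: cvg_EFin; first exact: nearW.
  (* Stdlib's R only has a canonical normed structure as R^o. *)
  apply/(@cvgrPdist_lt _ R^o) => e /fx[d d0 dP].
  apply: filterS (mesh0 _ d0) => n nd.
  have [_ _ /(_ _ xab)[y [yab xy /= ->]]] := gP n.
  by apply: dP; rewrite ?in_itv//=; exact: le_lt_trans nd.
have aegf : {ae leb, forall x, `[a, b]%classic x ->
    (EFin \o g n) x @[n --> \oo] --> (EFin \o f) x}.
  apply: negligibleS nD => x /=; rewrite in_itv/= => /not_implyP[xab gx].
  by apply: contrapT => Dx; apply: gx; exact: gf.
have mg n : measurable_fun (`[a, b]%classic : set lebesgueR) (EFin \o g n).
  by have [] := gP n.
have mf : measurable_fun (`[a, b]%classic : set lebesgueR) (EFin \o f).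
  (* Measurability of [f] is derived, not assumed: [f] agrees almost everywhere with the upper limit
     of the measurable [g n], and [leb] is complete. *)
  apply: (ae_measurable_fun completed_lebesgue_measure_is_complete _
    (measurable_fun_limn_esup mg)).
  apply: negligibleS aegf => x /= neq gx; apply: neq => /gx.
  by move=> /cvg_limn_einf_sup[_].
have iM : leb.-integrable `[a, b] (EFin \o cst M).
  apply: measurable_bounded_integrable => //.
  - by rewrite /= leb_itv// ltry.
  - exists `|M|; split; first exact: num_real.
    by move=> y My x _; exact: ltW.
have gM : {ae leb, forall x, forall n, `[a, b]%classic x ->
    (`|(EFin \o g n) x| <= (EFin \o cst M) x)%E}.
  apply: aeW => x n /=; rewrite in_itv/= => xab.
  have [_ _ /(_ _ xab)[y [yab _ /= ->]]] := gP n.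
  by rewrite lee_fin fM// in_itv.
have [fi _ fc] := dominated_convergence mI mg mf aegf iM gM.
split => //; move: fc; rewrite (_ : [sequence _]_n = fun n => (Rsum f (s n))%:E)//.
by apply/funext => n; have [] := gP n.
Qed.

(** * Oscillation of a Riemann integrable function *)

Lemma fine_partition (a b e : R) : a <= b -> 0 < e ->
  exists P : seq R, [/\ SF_seq.sorted Rle (a :: P), last a P = b &
    SF_seq.seq_step (a :: P) < e].
Proof.
move=> /RleP ab /RltP e0.
have [n /RltP ne] := SF_seq.seq_step_unif_part_ex a b (mkposreal e e0).
have := SF_seq.unif_part_sort a b n ab; move: ne.
have := SF_seq.last_unif_part a a b n; have := SF_seq.head_unif_part a a b n.
by case E: (SF_seq.unif_part a b n) => [//|x P] /= -> <-; exists P.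
Qed.

(** Tags are given as a function of the endpoints of a cell, so that two choices of tags can be
    compared on one and the same partition. *)
Lemma subdivides_f2 (t : R -> R -> R) (x : R) (P : seq R) :
  (forall c d, c <= d -> c <= t c d <= d) -> SF_seq.sorted Rle (x :: P) ->
  subdivides x (last x P) (SF_seq.SF_seq_f2 t (x :: P)).
Proof.
move=> tP sP; split=> //.
  by apply: SF_seq.ptd_f2 => // c d /RleP /tP /andP[/RleP ? /RleP ?].
by rewrite SF_seq.SF_lx_f2//; exact/ssrnat.ltP.
Qed.

Lemma mesh_f2 (t : R -> R -> R) (x : R) (P : seq R) :
  mesh (SF_seq.SF_seq_f2 t (x :: P)) = SF_seq.seq_step (x :: P).
Proof. by rewrite SF_seq.SF_lx_f2//; exact/ssrnat.ltP. Qed.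

(** By induction on the partition: a cell whose interior meets [E] joins the cover and contributes
    at least [k] times its length to the difference of the sums. Any other cell contributes a
    nonnegative amount, and only its endpoints can lie in [E]. *)
Lemma oscillation_cover (f : R -> R) (k : R) (E : set R) (s t : R -> R -> R) :
  0 <= k -> (forall c d, f (t c d) <= f (s c d)) ->
  (forall c d x, E x -> c < x < d -> k <= f (s c d) - f (t c d)) ->
  forall (P : seq R) (x : R), SF_seq.sorted Rle (x :: P) ->
  exists A : set lebesgueR, [/\ measurable A, E `&` `[x, last x P] `<=` A &
    (k%:E * leb A <= (Rsum f (SF_seq.SF_seq_f2 s (x :: P)) -
                         Rsum f (SF_seq.SF_seq_f2 t (x :: P)))%:E)%E].
Proof.
move=> k0 ts kE; elim=> [x _|y P IH x [/RleP xy sP]].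
  exists `[x, x]%classic; split; first exact: measurable_leb_itv.
    by move=> ? [].
  by rewrite leb_itv// subrr mule0 lee_fin subrr.
have [A [mA EA kA]] := IH _ sP.
(* The interval from [x] to [z] is the whole cell if its interior meets [E], and otherwise the null
   set reduced to [x]; the right endpoint [y] is left to the cover [A] of the tail. *)
pose z := if `[< exists2 u, E u & x < u < y >] then y else x.
have xz : x <= z by rewrite /z; case: ifP.
exists (`[x, z] `|` A); split.
- by apply: measurableU => //; exact: measurable_leb_itv.
- move=> u [Eu /=]; rewrite !in_itv/= => /andP[xu uP].
  have [yu|uy] := leP y u; [right|left].
    by apply: EA; split=> //=; rewrite in_itv/= yu.
  rewrite xu/= /z; case: ifPn => [_|/asboolPn nE]; first exact: ltW.
  by rewrite leNgt; apply/negP => xu'; apply: nE; exists u; rewrite ?xu'.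
- have F r : SF_seq.SF_seq_f2 r [:: x, y & P] =
    SF_seq.SF_cons (x, r x y) (SF_seq.SF_seq_f2 r (y :: P)) by [].
  rewrite !F !Rsum_cons [start _]/= opprD addrACA -mulrBr EFinD.
  apply: (@le_trans _ _ (k%:E * (leb `[x, z]%classic + leb A))%E).
    rewrite lee_wpmul2l ?lee_fin//.
    by apply: (measureU2 leb) => //; exact: measurable_leb_itv.
  rewrite ge0_muleDr// leeD// leb_itv// lee_fin mulrC /z.
  case: ifPn => [/asboolP[u Eu xuy]|_].
    by rewrite ler_wpM2l ?subr_ge0// (kE _ _ _ Eu).
  by rewrite subrr mul0r mulr_ge0// subr_ge0.
Qed.

Lemma negligible_oscillation (f : R -> R) (a b k : R) (E : set R) :
  a < b -> 0 < k -> Riemann_integrable_on a b f -> E `<=` `[a, b] ->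
  (forall c d x, E x -> c < x < d -> exists u v,
    [/\ c <= u <= d, c <= v <= d & k <= f u - f v]) ->
  leb.-negligible E.
Proof.
move=> ab k0 [I /(is_RIntP _ _ _ _ ab) fI] Eab oscE.
(* If no point of [E] lies strictly inside the cell, both tags are its left endpoint and their
   values cancel. *)
have /choice[p pP] (cd : R * R) : exists uv : R * R,
    [/\ cd.1 <= cd.2 -> cd.1 <= uv.1 <= cd.2 /\ cd.1 <= uv.2 <= cd.2,
        f uv.2 <= f uv.1 &
        forall x, E x -> cd.1 < x < cd.2 -> k <= f uv.1 - f uv.2].
  case: cd => c d /=; have [[x Ex xcd]|nE] := pselect (exists2 x, E x & c < x < d).
    have [u [v [ucd vcd kuv]]] := oscE _ _ _ Ex xcd; exists (u, v); split=> //=.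
    by rewrite -subr_ge0 (le_trans (ltW k0)).
  exists (c, c); split=> //= [->|x Ex xcd]; first by rewrite lexx.
  by case: nE; exists x.
pose s c d := (p (c, d)).1; pose t c d := (p (c, d)).2.
have sP c d : c <= d -> c <= s c d <= d by move=> cd; have [/(_ cd)[]] := pP (c, d).
have tP c d : c <= d -> c <= t c d <= d by move=> cd; have [/(_ cd)[]] := pP (c, d).
have cover e : 0 < e -> exists A : set lebesgueR,
    [/\ measurable A, E `<=` A & (leb A <= e%:E)%E].
  (* Both sums lie within [k * e / 2] of [I], hence differ by less than [k * e]; dividing by [k]
     bounds the measure of the cover by [e]. *)
  move=> e0; have [|d d0 dP] := fI (k * e / 2); first by rewrite divr_gt0 ?mulr_gt0.
  have [P [Ps Pb Pd]] := fine_partition _ _ _ (ltW ab) d0.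
  have [||A [mA EA kA]] := oscillation_cover f k E s t (ltW k0) _ _ P a Ps.
  - by move=> c c'; have [] := pP (c, c').
  - by move=> c c' x Ex xcc; have [_ _ /(_ x Ex xcc)] := pP (c, c').
  exists A; split=> //.
    by move=> x Ex; apply: EA; split=> //; rewrite Pb; exact: Eab.
  rewrite -(@lee_pmul2l _ k%:E)//; apply: (le_trans kA); rewrite -EFinM lee_fin.
  have := subdivides_f2 _ _ _ sP Ps; rewrite Pb => /dP; rewrite mesh_f2 => /(_ Pd).
  have := subdivides_f2 _ _ _ tP Ps; rewrite Pb => /dP; rewrite mesh_f2 => /(_ Pd).
  rewrite !ltr_norml; lra.
(* The intersection of covers of measure at most 1/(n+1) is a measurable null set containing [E]. *)
have /choice[A AP] n := cover n.+1%:R^-1 (ltac:(by rewrite invr_gt0)).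
have mA : measurable (\bigcap_n A n).
  by apply: bigcapT_measurable => n; have [] := AP n.
exists (\bigcap_n A n); split=> //; last first.
  by move=> x Ex n _; have [_ + _] := AP n; exact.
apply/eqP; rewrite eq_le measure_ge0 andbT; apply/lee_addgt0Pr => e e0.
rewrite add0e; have [n ne] : exists n, n.+1%:R^-1 < e.
  by near \oo => n; exists n; near: n; exact: near_infty_natSinv_lt (PosNum e0).
have [mAn _ An] := AP n; apply: (@le_trans _ _ (leb (A n))).
  by apply: le_measure; rewrite ?inE//; exact: bigcap_inf.
by apply: (le_trans An); rewrite lee_fin ltW.
Unshelve. all: by end_near. Qed.

(** Discontinuity at [x] means that some jump away from [f x] persists arbitrarily near [x].
    Comparing its size with 1/(n+1) places [x] in a countable union of sets [E n], each null by
    [negligible_oscillation]. *)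
Lemma negligible_discontinuity_set (f : R -> R) (a b : R) : a < b ->
  Riemann_integrable_on a b f -> leb.-negligible (discontinuity_set a b f).
Proof.
move=> ab fI.
pose E n := [set x | `[a, b]%classic x /\ forall d, 0 < d ->
  exists y, [/\ y \in `[a, b], `|x - y| < d & n.+1%:R^-1 <= `|f x - f y|]].
have nE n : leb.-negligible (E n).
  apply: (negligible_oscillation f a b n.+1%:R^-1) => //; first by move=> x [].
  move=> c d x [xab /(_ (Num.min (x - c) (d - x)))] Ex /andP[cx xd].
  (* This radius keeps [y] inside the cell, so [x] and [y] can be the two tags, ordered by the sign
     of [f x - f y]. *)
  have [|y [yab + kxy]] := Ex; first by rewrite lt_min !subr_gt0 cx.
  rewrite lt_min !ltr_norml => xy.
  have xcd : c <= x <= d by rewrite !ltW.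
  have ycd : c <= y <= d by move: xy; lra.
  move: kxy; rewrite ler_normr => /orP[?|].
    by exists x, y.
  by rewrite opprB => ?; exists y, x.
apply: negligibleS (negligible_bigcup nE) => x [xab nfx].
apply: contrapT => nEx; apply: nfx; apply/cvg_withinP => e e0.
have [n ne] : exists n, n.+1%:R^-1 < e.
  by near \oo => n; exists n; near: n; exact: near_infty_natSinv_lt (PosNum e0).
apply: contrapT => nd; apply: nEx; exists n => //; split=> // d d0.
apply: contrapT => ny; apply: nd; exists d => // y yab xy.
rewrite ltNge; apply/negP => exy; apply: ny; exists y; split=> //.
exact: le_trans (ltW ne) exy.
Unshelve. all: by end_near. Qed.

(** * Equality of the two integrals *)

Lemma subdivides_nil (a : R) : subdivides a a (SF_seq.SF_nil a).
Proof. by split=> // i /ssrnat.ltP. Qed.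

Lemma is_RInt_Lebesgue (a b M : R) (f : R -> R) : a <= b ->
  (forall x : R, x \in `[a, b] -> `|f x| <= M) ->
  leb.-negligible (discontinuity_set a b f) ->
  exists I, [/\ leb.-integrable `[a, b] (EFin \o f),
    (\int[leb]_(x in `[a, b]) (f x)%:E = I%:E)%E & is_RInt f a b I].
Proof.
rewrite le_eqVlt => /predU1P[<- fM nD|ab fM nD].
  (* On a degenerate interval the subdivision without cells has mesh 0 and sum 0, so both integrals
     vanish. *)
  have [_|d d0|fi fc] := Rsum_cvg_integral a a M f (fun=> SF_seq.SF_nil a) fM nD.
  - exact: subdivides_nil.
  - exact: nearW.
  exists 0; split=> //; last exact: RInt.is_RInt_point.
  by apply/esym/(cvg_unique _ _ fc) => //; exact: cvg_cst.
have fine_subdivision d : 0 < d -> exists s, subdivides a b s /\ mesh s < d.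
  move=> d0; have [P [sP <- Pd]] := fine_partition _ _ _ (ltW ab) d0.
  exists (SF_seq.SF_seq_f2 (fun c _ => c) (a :: P)); rewrite mesh_f2; split=> //.
  by apply: subdivides_f2 => // c d'; rewrite lexx.
have inv0 n : 0 < n.+1%:R^-1 :> R by rewrite invr_gt0.
have mesh0 (s : nat -> subdivision) : (forall n, mesh (s n) < n.+1%:R^-1) ->
    forall d, 0 < d -> \forall n \near \oo, mesh (s n) < d.
  move=> sn d d0; near=> n; apply: lt_trans (sn n) _.
  by near: n; exact: near_infty_natSinv_lt (PosNum d0).
(* This first sequence serves only to make [f] integrable, so that its integral is finite and [fine]
   loses nothing. *)
have [s /all_and2[sab smesh]] := choice (fun n => fine_subdivision _ (inv0 n)).
have [fi _] := Rsum_cvg_integral a b M f s fM nD sab (mesh0 _ smesh).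
have If := integrable_fin_num (measurable_leb_itv _) fi.
exists (fine (\int[leb]_(x in `[a, b]) (f x)%:E)); split=> //.
  by rewrite fineK.
apply/is_RIntP => // e e0; apply: contrapT => nd.
(* Were the Riemann sums not to converge, there would be subdivisions of mesh below 1/(n+1) with
   sums at distance at least [e] from the integral, against [Rsum_cvg_integral]. *)
have /choice[r /all_and3[rab rmesh re]] n : exists s, [/\ subdivides a b s,
    mesh s < n.+1%:R^-1 & e <= `|Rsum f s - fine (\int[leb]_(x in `[a, b]) (f x)%:E)|].
  apply: contrapT => ns; apply: nd; exists n.+1%:R^-1 => // s' s1 s2.
  by rewrite ltNge; apply/negP => s3; apply: ns; exists s'.
have [_] := Rsum_cvg_integral a b M f r fM nD rab (mesh0 _ rmesh).
rewrite -(fineK If) => /fine_cvgP[_ /(@cvgrPdist_lt _ R^o)/(_ e e0)].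
by move=> /filter_ex[n]; rewrite /= distrC ltNge re.
Unshelve. all: by end_near. Qed.

Theorem proposition3 (a b M : R) (f : R -> R) (hab : a <= b)
    (hM : forall x : R, x \in `[a, b] -> `|f x| <= M) :
  let lambda := @completed_lebesgue_measure R in
  (Riemann_integrable_on a b f <->
   lambda.-negligible (discontinuity_set a b f))
  /\
  (Riemann_integrable_on a b f ->
   lambda.-integrable `[a, b] (EFin \o f) /\
   (Riemann_integral a b f)%:E = (\int[lambda]_(x in `[a, b]) (f x)%:E)%E).
Proof.
move=> lambda; rewrite {}/lambda.
have Rneg : Riemann_integrable_on a b f -> leb.-negligible (discontinuity_set a b f).
  (* For [a = b] the discontinuity set lies in a single point. *)
  move: hab; rewrite le_eqVlt => /predU1P[<- _|];
    last exact: negligible_discontinuity_set.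
  exists `[a, a]%classic; split; first exact: measurable_leb_itv.
    by rewrite leb_itv// subrr.
  by move=> x [].
split; first split=> // nD.
  by have [I [_ _ fI]] := is_RInt_Lebesgue a b M f hab hM nD; exists I.
move=> /Rneg nD; have [I [fi If fI]] := is_RInt_Lebesgue a b M f hab hM nD.
split=> //; rewrite If; congr EFin.
exact: (@RInt.is_RInt_unique Hierarchy.R_CompleteNormedModule f a b I).
Qed.
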